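(* Suppose that the following hold. (A1) For every $c\in\mathbb R$ the level set $\{x\in\mathbb R^n\mid \zeta(x)\le c\}$ is bounded. (A4) For every candidate cluster point $x^*$ of the sequence $\{x^k\}$ generated by the hybrid perturbed DCA and every $i\in\mathcal M(x^* )$, the exposed direction set $\mathcal A_i^*$ at $x^*$ is nonempty. Let $\{x^k\}$ be generated by the hybrid perturbed DCA. Then, with probability one, every cluster point of $\{x^k\}$ is a d-stationary point of $\zeta$.
   Context: Problem. $\mathcal I$ is a finite index set, $\phi:\mathbb R^n\to(-\infty,+\infty]$ is proper closed convex, and $\psi_i:\mathbb R^n\to\mathbb R$ ($i\in\mathcal I$) are pairwise distinct, convex and continuously differentiable. Put $\psi(x)=\max_{i\in\mathcal I}\psi_i(x)$ and $\zeta(x)=\phi(x)-\psi(x)$; the problem is $\min_{x\in\mathbb R^n}\zeta(x)$. Active index set: $\mathcal M(x)=\{i\in\mathcal I\mid\psi_i(x)=\psi(x)\}$. $\mathbb S^{n-1}$ is the Euclidean unit sphere in $\mathbb R^n$. d-stationarity. $x^*\in\operatorname{dom}(\zeta)$ is a d-stationary point if $\zeta'(x^*;x-x^* )\ge0$ for all $x\in\mathbb R^n$, where $\zeta'(x;d)=\lim_{\tau\downarrow0}(\zeta(x+\tau d)-\zeta(x))/\tau$. Exposed directions at $x^*$. For $i\in\mathcal M(x^* )$, $$\mathcal A_i^*=\{d\in\mathbb S^{n-1}\mid\langle\nabla\psi_i(x^* )-\nabla\psi_j(x^* ),d\rangle>0\ \ \forall j\in\mathcal M(x^* )\setminus\{i\}\}$$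 (so $\mathcal A_i^*=\mathbb S^{n-1}$ if $\mathcal M(x^* )=\{i\}$). Hybrid perturbed DCA. For $z,g\in\mathbb R^n$ let $T(z,g)=\arg\min_{x\in\mathbb R^n}\{\phi(x)-\langle g,x-z\rangle+\frac\sigma2\|x-z\|^2\}$. Given $x^0\in\operatorname{dom}(\zeta)$, $\sigma>0$, $\eta\in(0,\sigma/2)$, $\bar\alpha>0$, for $k=0,1,2,\dots$: 1. sample $\alpha_k\sim\mathrm{Unif}(0,\bar\alpha)$ and $\xi^k\sim\mathrm{Unif}(\mathbb S^{n-1})$, independently of each other and of the past, and set $\hat x^k=x^k+\alpha_k\xi^k$; 2. choose any $i_k\in\mathcal M(\hat x^k)$, set $g^k=\nabla\psi_{i_k}(\hat x^k)$, $y^k=T(\hat x^k,g^k)$, $v_k=\|y^k-\hat x^k\|$; 3. if $\zeta(y^k)\le\zeta(x^k)-\eta v_k^2$, set $x^{k+1}=y^k$ and $r_k=v_k$; otherwise choose any $j_k\in\mathcal M(x^k)$, set $h^k=\nabla\psi_{j_k}(x^k)$, $d^k=T(x^k,h^k)$, $x^{k+1}=d^k$ and $r_k=\|d^k-x^k\|$. *)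

(* Defs.v *)
From HB Require Import structures.
From mathcomp Require Import all_boot all_order all_algebra.
From mathcomp Require Import all_classical all_reals all_analysis.

Set Implicit Arguments.
Unset Strict Implicit.
Unset Printing Implicit Defensive.

Import Order.TTheory GRing.Theory Num.Theory.
Import numFieldNormedType.Exports.

Local Open Scope classical_set_scope.
Local Open Scope ring_scope.

(* Matrices, hence the row vectors of R^n, carry their Borel sigma-algebra. *)
HB.instance Definition _ (R : realType) (m n : nat) :=
  @isMeasurable.Build (sigma_display (@open 'M[R]_(m, n))) 'M[R]_(m, n)
    <<s @open 'M[R]_(m, n) >> (@sigma_algebra0 _ setT _) (@sigma_algebraC _ _)
    (@sigma_algebra_bigcup _ setT _).

(* The library norm `|x| on 'rV[R]_n is the sup norm. It induces the same
   topology, bounded sets and differentiability as the Euclidean norm, but the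
   latter is needed for the sphere and for the algorithm. *)
Definition dot (R : realType) (n : nat) (u v : 'rV[R]_n) : R :=
  \sum_(l < n) u 0 l * v 0 l.

Definition enorm (R : realType) (n : nat) (u : 'rV[R]_n) : R :=
  Num.sqrt (dot u u).

Definition sphere (R : realType) (n : nat) : set 'rV[R]_n :=
  [set u | enorm u = 1].
Arguments sphere : clear implicits.

Definition grad (R : realType) (n : nat) (f : 'rV[R]_n -> R) (x : 'rV[R]_n) :
    'rV[R]_n :=
  \row_(l < n) 'D_(delta_mx 0 l) f x.

Definition continuously_differentiable (R : realType) (n : nat)
    (f : 'rV[R]_n -> R) : Prop :=
  (forall x, differentiable f x) /\ continuous (grad f).

Definition proper (R : realType) (n : nat) (f : 'rV[R]_n -> \bar R) : Prop :=
  (forall x, (-oo < f x)%E) /\ (exists x, (f x < +oo)%E).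

(* Meant for functions without the value -oo; since 0 * +oo = 0 in \bar R, the
   cases t = 0 and t = 1 are harmless. *)
Definition econvex (R : realType) (n : nat) (f : 'rV[R]_n -> \bar R) : Prop :=
  forall (x y : 'rV[R]_n) (t : R), 0 <= t <= 1 ->
    (f (t *: x + (1 - t) *: y)%R <= t%:E * f x + (1 - t)%:E * f y)%E.

(* For extended-real-valued functions, closed means lower semicontinuous. *)
Definition proper_closed_convex (R : realType) (n : nat)
    (f : 'rV[R]_n -> \bar R) : Prop :=
  [/\ proper f, lower_semicontinuous f & econvex f].

(* The index i0 witnesses that I is nonempty and seeds the maximum, whose
   value does not depend on it. *)
Definition psi_max (R : realType) (n : nat) (I : finType) (i0 : I)
    (psi : I -> 'rV[R]_n -> R) (x : 'rV[R]_n) : R :=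
  \big[Num.max/psi i0 x]_(i : I) psi i x.

Definition zeta (R : realType) (n : nat) (I : finType) (i0 : I)
    (phi : 'rV[R]_n -> \bar R) (psi : I -> 'rV[R]_n -> R) (x : 'rV[R]_n) :
    \bar R :=
  (phi x - (psi_max i0 psi x)%:E)%E.

Definition dom (R : realType) (n : nat) (f : 'rV[R]_n -> \bar R) :
    set 'rV[R]_n :=
  [set x | (f x < +oo)%E].

Definition active (R : realType) (n : nat) (I : finType) (i0 : I)
    (psi : I -> 'rV[R]_n -> R) (x : 'rV[R]_n) : set I :=
  [set i | psi i x = psi_max i0 psi x].

(* The directional derivative f'(x; d) exists in the extended reals and equals
   l; meant for x with f x finite. *)
Definition is_dirderiv (R : realType) (n : nat) (f : 'rV[R]_n -> \bar R)
    (x d : 'rV[R]_n) (l : \bar R) : Prop :=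
  ((f (x + tau *: d)%R - f x) * (tau^-1)%:E)%E @[tau --> (0 : R)^'+] --> l.

Definition d_stationary (R : realType) (n : nat) (f : 'rV[R]_n -> \bar R)
    (xs : 'rV[R]_n) : Prop :=
  dom f xs /\
  forall x, exists2 l, is_dirderiv f xs (x - xs) l & (0 <= l)%E.

Definition exposed_directions (R : realType) (n : nat) (I : finType) (i0 : I)
    (psi : I -> 'rV[R]_n -> R) (xs : 'rV[R]_n) (i : I) : set 'rV[R]_n :=
  [set d | sphere R n d /\
    forall j, active i0 psi xs j -> j <> i ->
      0 < dot (grad (psi i) xs - grad (psi j) xs) d].

Definition argmin (R : realType) (n : nat) (f : 'rV[R]_n -> \bar R) :
    set 'rV[R]_n :=
  [set y | forall x, (f y <= f x)%E].

(* For phi proper closed convex and sigma > 0 this set is a singleton, so that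
   T phi sigma z g y renders y = T(z, g). *)
Definition T (R : realType) (n : nat) (phi : 'rV[R]_n -> \bar R) (sigma : R)
    (z g : 'rV[R]_n) : set 'rV[R]_n :=
  argmin (fun x =>
    (phi x - (dot g (x - z)%R)%:E + (sigma / 2 * enorm (x - z)%R ^+ 2)%:E)%E).

(* Passage from xk to xnext when the perturbed point is xhat. *)
Definition hybrid_step (R : realType) (n : nat) (I : finType) (i0 : I)
    (phi : 'rV[R]_n -> \bar R) (psi : I -> 'rV[R]_n -> R) (sigma eta : R)
    (xk xhat xnext : 'rV[R]_n) : Prop :=
  exists i y,
    [/\ active i0 psi xhat i,
        T phi sigma xhat (grad (psi i) xhat) y &
        if (zeta i0 phi psi y <=
            zeta i0 phi psi xk - (eta * enorm (y - xhat) ^+ 2)%:E)%E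
        then xnext = y
        else exists2 j, active i0 psi xk j &
               T phi sigma xk (grad (psi j) xk) xnext].

Definition uniform_itv_law (R : realType) (a b : R) (ab : a < b)
    (mu : set R -> \bar R) : Prop :=
  forall A : set R, measurable A -> mu A = uniform_prob ab A.

(* The uniform distribution on the unit sphere is the Borel probability measure
   carried by the sphere and invariant under all orthogonal transformations. *)
Definition uniform_sphere_law (R : realType) (n : nat)
    (mu : set 'rV[R]_n -> \bar R) : Prop :=
  mu (sphere R n) = 1%E /\
  forall (Q : 'M[R]_n) (A : set 'rV[R]_n), Q *m Q^T = 1%:M -> measurable A ->
    mu ((fun u => u *m Q) @^-1` A) = mu A.

(* The sigma-algebra generated by x^0, ..., x^k and by the samples drawn before
   iteration k. *)
Definition past (d : measure_display) (Omega : measurableType d)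
    (R : realType) (n : nat) (alpha : nat -> Omega -> R)
    (xi x : nat -> Omega -> 'rV[R]_n) (k : nat) : set (set Omega) :=
  <<s [set E | exists l, exists2 A, (l <= k)%N /\ measurable A &
                 E = x l @^-1` A] `|`
      [set E | exists l, exists2 B, (l < k)%N /\ measurable B &
                 E = alpha l @^-1` B] `|`
      [set E | exists l, exists2 C, (l < k)%N /\ measurable C &
                 E = xi l @^-1` C] >>.

(* Mutual independence of alpha_k, xi^k and the past: each factor may be
   dropped by taking the corresponding set to be full. *)
Definition fresh_samples (d : measure_display) (Omega : measurableType d)
    (R : realType) (n : nat) (P : probability Omega R)
    (alpha : nat -> Omega -> R) (xi x : nat -> Omega -> 'rV[R]_n) (k : nat) :
    Prop :=
  forall (E : set Omega) (B : set R) (C : set 'rV[R]_n),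
    past alpha xi x k E -> measurable B -> measurable C ->
    (P (E `&` alpha k @^-1` B `&` xi k @^-1` C) =
     P E * P (alpha k @^-1` B) * P (xi k @^-1` C))%E.

(* The indices i_k and j_k are existentially chosen in hybrid_step, separately
   for each k and each outcome, so any selection rule is allowed as long as the
   iterates are random vectors. *)
Record hybrid_perturbed_DCA (d : measure_display) (Omega : measurableType d)
    (R : realType) (n : nat) (P : probability Omega R) (I : finType) (i0 : I)
    (phi : 'rV[R]_n -> \bar R) (psi : I -> 'rV[R]_n -> R) (x0 : 'rV[R]_n)
    (sigma eta abar : R) (abar_gt0 : 0 < abar)
    (alpha : nat -> {RV P >-> R}) (xi x : nat -> {RV P >-> 'rV[R]_n}) : Prop :=
  HybridPerturbedDCA {
    dca_init : forall w, x 0%N w = x0;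
    dca_alpha : forall k, uniform_itv_law abar_gt0 (distribution P (alpha k));
    dca_xi : forall k, uniform_sphere_law (distribution P (xi k));
    dca_indep : forall k, fresh_samples P alpha xi x k;
    dca_step : forall k w,
      hybrid_step i0 phi psi sigma eta
        (x k w) (x k w + alpha k w *: xi k w) (x k.+1 w) }.

(* Main.v *)
Require Import Defs.
From mathcomp Require Import all_boot all_order all_algebra.
From mathcomp Require Import all_classical all_reals all_analysis.
From mathcomp Require Import measurable_realfun.
From mathcomp Require Import ring lra.

(* The iterates never increase zeta, which is bounded below. Let x* be a cluster
   point that is not d-stationary. Then x* is not a fixed point of
   T(., grad psi_i) for some active i, so by lower semicontinuity steps of T with
   index i taken near x* have length bounded away from 0. A small perturbation
   along a direction exposing i makes i the only active index and changes the
   model by an arbitrarily small amount. Hence there are neighborhoods U of x*,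
   J of some a in (0, abar) and C of some point of the sphere such that
   x^k in U, alpha_k in J and xi^k in C force zeta to drop by a fixed amount.
   This can happen at most N times on every run, while by independence its
   probability is at least p P(x^k in U) with p > 0 independent of k. So
   sum_k P(x^k in U) <= N / p, and by the first Borel-Cantelli lemma almost
   surely x^k is in U only finitely often. Countably many rational balls take
   care of all such x* at once. *)

Set Implicit Arguments.
Unset Strict Implicit.
Unset Printing Implicit Defensive.

Import Order.TTheory GRing.Theory Num.Theory.
Import numFieldNormedType.Exports.
Local Open Scope classical_set_scope.
Local Open Scope ring_scope.

(** * Euclidean inner product on row vectors *)

Section InnerProduct.
Context {R : realType} {n : nat}.
Implicit Types u v w : 'rV[R]_n.

Lemma dotC u v : dot u v = dot v u.
Proof. by apply: eq_bigr => l _; rewrite mulrC. Qed.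

Lemma dotDl u v w : dot (u + v) w = dot u w + dot v w.
Proof. by rewrite -big_split; apply: eq_bigr => l _; rewrite mxE mulrDl. Qed.

Lemma dotZl a u v : dot (a *: u) v = a * dot u v.
Proof. by rewrite /dot mulr_sumr; apply: eq_bigr => l _; rewrite mxE mulrA. Qed.

Lemma dotBl u v w : dot (u - v) w = dot u w - dot v w.
Proof. by rewrite dotDl -scaleN1r dotZl mulN1r. Qed.

Lemma dotBr u v w : dot u (v - w) = dot u v - dot u w.
Proof. by rewrite dotC dotBl !(dotC u). Qed.

Lemma dotZr a u v : dot u (a *: v) = a * dot u v.
Proof. by rewrite dotC dotZl dotC. Qed.

Lemma dot0r u : dot u 0 = 0.
Proof. by rewrite /dot big1// => l _; rewrite mxE mulr0. Qed.

Lemma dot_mx u v : dot u v = (u *m v^T) 0 0.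
Proof. by rewrite mxE; apply: eq_bigr => l _; rewrite mxE. Qed.

Lemma sqr_coord_le_dot u l : u 0 l ^+ 2 <= dot u u.
Proof.
rewrite /dot (bigD1 l)//= -expr2 lerDl sumr_ge0// => i _.
by rewrite -expr2 sqr_ge0.
Qed.

Lemma dot_ge0 u : 0 <= dot u u.
Proof. by apply: sumr_ge0 => i _; rewrite -expr2 sqr_ge0. Qed.

Lemma dot_eq0 u : dot u u = 0 -> u = 0.
Proof.
move=> u0; apply/rowP => l; rewrite mxE; apply/eqP.
by rewrite -sqrf_eq0 eq_le sqr_ge0 -u0 sqr_coord_le_dot.
Qed.

Lemma enorm_sqr u : enorm u ^+ 2 = dot u u.
Proof. by rewrite sqr_sqrtr// dot_ge0. Qed.

Lemma sphereE : sphere R n = [set u | dot u u = 1].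
Proof.
apply/seteqP; split=> u /= h; first by rewrite -enorm_sqr h expr1n.
by rewrite /sphere/= /enorm h sqrtr1.
Qed.

Lemma cvg_dot (S : Type) (F : set_system S) (f g : S -> 'rV[R]_n) u v :
  Filter F -> f @ F --> u -> g @ F --> v ->
  dot (f x) (g x) @[x --> F] --> dot u v.
Proof.
move=> FF fu gv; apply: cvg_big => [|l _]; first exact: add_continuous.
by apply: cvgM; [exact: cvg_comp fu (@coord_continuous _ _ _ _ _ _)
  |exact: cvg_comp gv (@coord_continuous _ _ _ _ _ _)].
Qed.

(** Every coordinate is dominated by the Euclidean norm. This turns Euclidean smallness into
    membership in the sup-norm balls that define the topology. *)
Lemma small_dot_ball u (r : R) : 0 < r -> dot u u < r ^+ 2 -> `|u| < r.
Proof.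
move=> r0 ur; rewrite [ltLHS]/Num.norm/= mx_normrE; apply/bigmax_ltP; split=> //= -[i l] _/=.
rewrite (ord1 i) -(ltr_pXn2r (ltn0Sn 1)) ?nnegrE ?normr_ge0 ?ltW// real_normK ?num_real//.
exact: le_lt_trans (sqr_coord_le_dot u l) ur.
Qed.

End InnerProduct.

(** * Gradients and the subgradient inequality *)

Section Gradient.
Context {R : realType} {n : nat}.
Implicit Types (f : 'rV[R]_n -> R) (u v x y : 'rV[R]_n).

Lemma deriv_grad f x v : differentiable f x -> 'D_v f x = dot (grad f x) v.
Proof.
move=> df; rewrite deriveE// {1}(matrix_sum_delta v) big_ord1 linear_sum.
by apply: eq_bigr => l _; rewrite linearZ/= mxE deriveE// mulrC.
Qed.

Lemma cvg_directional f x v : differentiable f x ->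
  (f (x + tau *: v) - f x) / tau @[tau --> 0^'+] --> dot (grad f x) v.
Proof.
move=> df; rewrite -deriv_grad//; apply: cvg_dnbhs_at_right.
have -> : (fun tau : R => (f (x + tau *: v) - f x) / tau) =
    (fun h => h^-1 *: ((f \o shift x) (h *: v) - f x)).
  by apply/funext => h /=; rewrite mulrC (addrC x).
exact: diff_derivable v df.
Qed.

Lemma convex_functionP f : convex_function [set: 'rV[R]_n] f ->
  forall x y (t : R), 0 <= t <= 1 ->
    f (t *: x + (1 - t) *: y) <= t * f x + (1 - t) * f y.
Proof.
move=> cf x y t /andP[t0 t1].
have := cf (@Itv01 _ t t0 t1) x y; apply; exact: in_setT.
Qed.

(** By convexity the difference quotient at [x] towards [y] is at most [f y - f x] for steps in (0,
    1]; let the step tend to 0. *)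
Lemma convex_gradient_le f x y : convex_function [set: 'rV[R]_n] f ->
  differentiable f x -> f x + dot (grad f x) (y - x) <= f y.
Proof.
move=> /convex_functionP cf df; rewrite -lerBrDl.
apply: (cvgr_to_le (@cvg_directional f x (y - x) df)).
near=> t.
have t0 : 0 < t by near: t; exact: nbhs_right_gt.
have t1 : t <= 1 by near: t; apply: nbhs_right_ltW.
rewrite ler_pdivrMr//; have := cf y x t; rewrite ltW// t1 => /(_ isT).
have -> : t *: y + (1 - t) *: x = x + t *: (y - x).
  by rewrite scalerBl scale1r scalerBr addrCA.
nra.
Unshelve. all: by end_near. Qed.

End Gradient.

(** * Finite maxima and active indices *)

Section PsiMax.
Context {R : realType} {n : nat} {I : finType} (i0 : I).
Variable psi : I -> 'rV[R]_n -> R.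

Lemma le_psi_max i x : psi i x <= psi_max i0 psi x.
Proof. exact: le_bigmax. Qed.

Lemma active_ex x : exists i, active i0 psi x i.
Proof.
suff [i e] : exists i, psi_max i0 psi x = psi i x by exists i.
rewrite /psi_max; elim/big_ind : _ => [|a b [i ->] [j ->]|i _].
- by exists i0.
- by rewrite /Num.max; case: ifP => _; [exists j|exists i].
- by exists i.
Qed.

Hypothesis psi_cont : forall i, continuous (psi i).

Lemma psi_max_continuous : continuous (psi_max i0 psi).
Proof.
move=> x; apply/(cvgrPdist_lt (FF := nbhs_filter x)) => e e0.
have : \forall y \near x, forall i, `|psi i x - psi i y| < e.
  by apply: (filter_forall (nbhs_filter x)) => i; move/cvgrPdist_lt : (@psi_cont i x); apply.
apply: filterS => y ye.
have [i ix] := active_ex x; have [j jy] := active_ex y.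
have := ye i; have := ye j.
have := le_psi_max j x; have := le_psi_max i y.
rewrite -ix -jy => h1 h2; rewrite !ltr_distl => /andP[h3 h4] /andP[h5 h6].
by apply/andP; split; lra.
Qed.

(** An inactive index has a positive gap to the maximum, which persists nearby by continuity;
    finitely many indices allow a common neighborhood. *)
Lemma active_near (x : 'rV[R]_n) : \forall y \near x, active i0 psi y `<=` active i0 psi x.
Proof.
have : \forall y \near x, forall j, ~ active i0 psi x j -> psi j y < psi_max i0 psi y.
  apply: (filter_forall (nbhs_filter x)) => j.
  have [jx|jx] := pselect (active i0 psi x j); first by apply: nearW.
  have {}jx : 0 < psi_max i0 psi x - psi j x.
    by rewrite subr_gt0 lt_neqAle le_psi_max andbT; apply/eqP.
  have c : psi_max i0 psi y - psi j y @[y --> x] --> psi_max i0 psi x - psi j x.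
    apply: (@cvgB _ _ _ _ (nbhs_filter x)); [exact: psi_max_continuous|exact: psi_cont].
  have c0 : \forall y \near x, 0 < psi_max i0 psi y - psi j y by exact: (cvgr_gt _ c _ jx).
  by rewrite near_simpl; apply: (filterS _ c0) => y; rewrite subr_gt0.
apply: filterS => y + j jy; have [//|jx /(_ j jx)] := pselect (active i0 psi x j).
by rewrite jy ltxx.
Qed.

End PsiMax.

(** * Monotone difference quotients of extended-valued convex functions *)

Section Quotient.
Context {R : realType} {n : nat}.

Lemma finite_between (y : \bar R) :
  (-oo < y)%E -> (y < +oo)%E -> exists a, y = a%:E.
Proof. by case: y => // a _ _; exists a. Qed.

(** The point [x + s *: d] is the convex combination of [x + t *: d] and [x] with weight [s / t] on
    the former. *)
Lemma econvex_quotient_le (f : 'rV[R]_n -> \bar R) (x d : 'rV[R]_n) (s t : R) :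
  econvex f -> (forall y, (-oo < f y)%E) -> (f x < +oo)%E -> 0 < s -> s <= t ->
  ((f (x + s *: d)%R - f x) * s^-1%:E <= (f (x + t *: d)%R - f x) * t^-1%:E)%E.
Proof.
move=> cf f_gtNy fx s0 st.
have t0 : 0 < t by exact: lt_le_trans st.
have [a fxa] := finite_between (f_gtNy x) fx.
have := cf (x + t *: d) x (s / t).
have -> : s / t *: (x + t *: d) + (1 - s / t) *: x = x + s *: d.
  rewrite scalerBl scale1r scalerDr scalerA divfK ?gt_eqF//.
  by rewrite addrC addrA subrK.
have st01 : 0 <= s / t <= 1 by rewrite ler_pdivrMr// mul1r st divr_ge0// ltW.
rewrite fxa => /(_ st01).
case: (f (x + t *: d)) (f_gtNy (x + t *: d)) => // [b _|_ _]; last first.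
  by rewrite addye// gt0_mulye ?lte_fin ?invr_gt0// leey.
case: (f (x + s *: d)) (f_gtNy (x + s *: d)) => // c _.
rewrite -!EFinB -!EFinM -EFinD !lee_fin => h.
rewrite ler_pdivrMr// mulrAC ler_pdivlMr//.
move: h; rewrite -(ler_pM2r t0).
rewrite mulrDl mulrAC divfK ?gt_eqF// => h.
suff e : (1 - s / t) * a * t = (t - s) * a by nra.
by field; rewrite gt_eqF.
Qed.

Lemma cvg_econvex_quotient (f : 'rV[R]_n -> \bar R) (x d : 'rV[R]_n) :
  econvex f -> (forall y, (-oo < f y)%E) -> (f x < +oo)%E ->
  cvg (((f (x + tau *: d)%R - f x) * tau^-1%:E)%E @[tau --> (0 : R)^'+]).
Proof.
move=> cf f_gtNy fx; apply: nondecreasing_at_right_is_cvge.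
apply: nearW => t s u; rewrite !in_itv/= => /andP[s0 _] _.
exact: econvex_quotient_le.
Qed.

End Quotient.

(** * Fixed points of the proximal map are d-stationary *)

Section Stationarity.
Context {R : realType} {n : nat} {I : finType} (i0 : I).
Variables (phi : 'rV[R]_n -> \bar R) (psi : I -> 'rV[R]_n -> R).
Hypothesis psi_convex : forall i, convex_function [set: 'rV[R]_n] (psi i).
Hypothesis psi_C1 : forall i, continuously_differentiable (psi i).

Lemma psi_continuous i : continuous (psi i).
Proof. by move=> x; apply: differentiable_continuous; case: (psi_C1 i). Qed.

Lemma psi_max_econvex : econvex (fun x => (psi_max i0 psi x)%:E).
Proof.
move=> x y t /[dup] t01 /andP[t0 t1].
rewrite -!EFinM -EFinD lee_fin.
have [i <-] := active_ex i0 psi (t *: x + (1 - t) *: y).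
apply: (le_trans (convex_functionP (@psi_convex i) x y t01)).
by apply: lerD; apply: ler_wpM2l; rewrite ?subr_ge0// le_psi_max.
Qed.

Lemma psi_max_gradient_le i x y : active i0 psi x i ->
  psi_max i0 psi x + dot (grad (psi i) x) (y - x) <= psi_max i0 psi y.
Proof.
move=> <-; apply: le_trans (le_psi_max i0 psi i y).
by apply: convex_gradient_le; [exact: psi_convex|case: (psi_C1 i)].
Qed.

(** The real-valued part of the objective of [T], kept apart from the extended-valued [phi] and
    written without square roots. *)
Definition prox_term (sigma : R) (z g x : 'rV[R]_n) : R :=
  sigma / 2 * dot (x - z) (x - z) - dot g (x - z).

Lemma T_leP sigma z g y : T phi sigma z g y <->
  forall x, (phi y + (prox_term sigma z g y)%:E <=
             phi x + (prox_term sigma z g x)%:E)%E.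
Proof.
have e x : (phi x - (dot g (x - z)%R)%:E + (sigma / 2 * enorm (x - z)%R ^+ 2)%:E)%E
    = (phi x + (prox_term sigma z g x)%:E)%E.
  by rewrite -addeA; congr (_ + _)%E; rewrite enorm_sqr /prox_term EFinB addeC.
by split=> h x; have := h x; rewrite !e.
Qed.

Lemma cvg_ray (x d : 'rV[R]_n) : x + t *: d @[t --> (0 : R)^'+] --> x.
Proof.
apply: cvg_at_right_filter; rewrite -[X in _ --> X]addr0 -[X in x + X](scale0r d).
by apply: cvgD; [exact: cvg_cst|apply: cvgZr_tmp; exact: cvg_id].
Qed.

(** On a short ray from [xs], an index [j] active at the moving point is also active at [xs]. The
    fixed-point property for this [j] bounds [phi] from below by its linearization up to a quadratic
    term, and differentiability of [psi j] bounds the maximum from above to first order. *)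
Lemma d_stationary_of_T sigma xs :
  (forall y, (-oo < phi y)%E) -> econvex phi -> (phi xs < +oo)%E ->
  (forall i, active i0 psi xs i -> T phi sigma xs (grad (psi i) xs) xs) ->
  d_stationary (zeta i0 phi psi) xs.
Proof.
move=> phi_gtNy cphi phixs Txs.
have [a phia] := finite_between (phi_gtNy xs) phixs.
split=> [|x]; first by rewrite /dom/= /zeta phia ltry.
set d := x - xs.
have /cvg_ex[/= lphi cvphi] := @cvg_econvex_quotient _ _ _ _ d cphi phi_gtNy phixs.
have /cvg_ex[/= lpsi cvpsi] := @cvg_econvex_quotient _ _ _ xs d psi_max_econvex
   (fun y => ltNyr _) (ltry (psi_max i0 psi xs)).
have [i iact] := active_ex i0 psi xs.
(* Finiteness excludes an indeterminate [lphi - lpsi]: the subgradient inequality bounds the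
   quotients from below, the quotient at step 1 from above. *)
have lpsi_fin : lpsi \is a fin_num.
  rewrite fin_real//; apply/andP; split.
    apply: (@lt_le_trans _ _ (dot (grad (psi i) xs) d)%:E); first exact: ltNyr.
    apply: (cvge_to_ge cvpsi); near=> t.
    have t0 : 0 < t by near: t; exact: nbhs_right_gt.
    rewrite -EFinB -EFinM lee_fin ler_pdivlMr// lerBrDl mulrC -dotZr.
    by have := psi_max_gradient_le (xs + t *: d) iact; rewrite (addrC xs) addrK.
  apply: (@le_lt_trans _ _ (psi_max i0 psi (xs + 1%:R *: d) - psi_max i0 psi xs)%:E); last exact: ltry.
  apply: (cvge_to_le cvpsi); near=> t.
  have t0 : 0 < t by near: t; exact: nbhs_right_gt.
  have t1 : t <= 1 by near: t; exact: nbhs_right_ltW.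
  have := @econvex_quotient_le _ _ _ xs d t 1 psi_max_econvex
   (fun y => ltNyr _) (ltry (psi_max i0 psi xs)) t0 t1.
  by rewrite invr1 mule1.
have cvzeta : is_dirderiv (zeta i0 phi psi) xs d (lphi - lpsi).
  have lB : (lphi +? - lpsi)%E by rewrite fin_num_adde_defl// fin_numN.
  apply: cvg_trans (cvgeB lB cvphi cvpsi); apply: near_eq_cvg; near=> t.
  have t0 : 0 < t by near: t; exact: nbhs_right_gt.
  rewrite /zeta phia -EFinB.
  case: (phi (xs + t *: d)) => [b||].
  - by rewrite -!EFinB -!EFinM; congr EFin; field; rewrite gt_eqF.
  - by rewrite -!EFinB -!EFinM !addye// gt0_mulye ?lte_fin ?invr_gt0// addye.
  - by rewrite -!EFinB -!EFinM !addNye// gt0_mulNye ?lte_fin ?invr_gt0// addNye.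
exists (lphi - lpsi)%E => //.
(* It suffices that the quotients of [zeta] are eventually at least [- e]. Half of [e] pays for the
   linearization of [psi j], half for the quadratic term. *)
apply/lee_addgt0Pr => e e0; rewrite -leeBlDr// sub0e -EFinN.
apply: (cvge_to_ge cvzeta); near=> t.
have t0 : 0 < t by near: t; exact: nbhs_right_gt.
have [j jact] := active_ex i0 psi (xs + t *: d).
have jxs : active i0 psi xs j.
  move: j jact; near: t.
  exact: (@cvg_ray xs d _ (active_near i0 psi_continuous xs)).
(* Since [j] depends on [t], the estimate is proved for all indices at once. *)
have jquot : (psi j (xs + t *: d) - psi j xs) / t < dot (grad (psi j) xs) d + e / 2.
  move: j {jact jxs}; near: t; apply: filter_forall => j.
  apply: cvgr_lt; first by apply: cvg_directional; case: (psi_C1 j).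
  by rewrite ltrDl divr_gt0.
have tsmall : sigma / 2 * t * dot d d < e / 2.
  near: t; have c : sigma / 2 * t * dot d d @[t --> (0 : R)^'+] --> sigma / 2 * 0 * dot d d.
    by apply: cvg_at_right_filter; apply: cvgMr_tmp; apply: cvgMl_tmp; exact: cvg_id.
  by apply: (cvgr_lt _ c); rewrite mulr0 mul0r divr_gt0.
have /T_leP/(_ (xs + t *: d)) := Txs j jxs.
rewrite /prox_term subrr (addrC xs) addrK !dot0r mulr0 subrr adde0 (addrC _ xs).
rewrite /zeta -jact -jxs phia dotZl !dotZr.
case: (phi (xs + t *: d)) (phi_gtNy (xs + t *: d)) => // [b _|_ _]; last first.
  by rewrite -EFinB !addye// gt0_mulye ?lte_fin ?invr_gt0// leey.
rewrite -!EFinB -EFinM -EFinD !lee_fin => h.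
move: jquot; rewrite ltr_pdivrMr// ler_pdivlMr// => h'.
nra.
Unshelve. all: by end_near. Qed.

End Stationarity.

(** * Descent of the hybrid step, and uniform decrease near non-fixed points *)

Section Descent.
Context {R : realType} {n : nat} {I : finType} (i0 : I).
Variables (phi : 'rV[R]_n -> \bar R) (psi : I -> 'rV[R]_n -> R).
Hypothesis phi_gtNy : forall y, (-oo < phi y)%E.
Hypothesis psi_convex : forall i, convex_function [set: 'rV[R]_n] (psi i).
Hypothesis psi_C1 : forall i, continuously_differentiable (psi i).
Variables sigma eta : R.
Hypotheses (sigma_gt0 : 0 < sigma) (eta_gt0 : 0 < eta) (eta_lt : eta < sigma / 2).

(** An accepted step descends by the acceptance test. In the fallback, compare the minimizer with
    [u] itself and add the subgradient inequality for the active index at [u]. *)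
Lemma hybrid_step_descent u h v :
  hybrid_step i0 phi psi sigma eta u h v ->
  (zeta i0 phi psi v <= zeta i0 phi psi u)%E.
Proof.
move=> [i [y [_ _]]]; case: ifPn => [acc ->|_ [j jact /T_leP/(_ u)]].
  apply: le_trans acc _; rewrite geeDl// oppe_le0 lee_fin enorm_sqr.
  by rewrite mulr_ge0 ?dot_ge0// ltW.
rewrite /prox_term subrr !dot0r mulr0 subrr adde0 /zeta.
have := psi_max_gradient_le psi_convex psi_C1 v jact.
case: (phi u) (phi_gtNy u) => // [b _|_ _ _]; last by rewrite addye// leey.
case: (phi v) (phi_gtNy v) => // c _ h1.
rewrite -EFinD -!EFinB !lee_fin => h2.
have : 0 <= sigma / 2 * dot (v - u) (v - u).
  by rewrite mulr_ge0 ?dot_ge0// divr_ge0// ltW.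
lra.
Qed.

Lemma cvg_prox_term (S : Type) (F : set_system S) (z g y : S -> 'rV[R]_n) z0 g0 y0 :
  Filter F -> z @ F --> z0 -> g @ F --> g0 -> y @ F --> y0 ->
  prox_term sigma (z s) (g s) (y s) @[s --> F] --> prox_term sigma z0 g0 y0.
Proof.
move=> FF zz gg yy; apply: cvgB; last by apply: cvg_dot => //; exact: cvgB.
by apply: cvgMl_tmp; apply: cvg_dot; exact: cvgB.
Qed.

(** Some [z0] beats [xs] in the model at [xs] by [3 * e]. If [z] is near [xs] and [y] is too near
    [z], then lower semicontinuity of [phi], the linear term at [y] and the change of the model at
    [z0] cost less than [e] each, so [z0] still beats [y]. *)
Lemma T_displacement (G : 'rV[R]_n -> 'rV[R]_n) xs :
  lower_semicontinuous phi -> {for xs, continuous G} -> (phi xs < +oo)%E ->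
  ~ T phi sigma xs (G xs) xs ->
  exists2 c, 0 < c &
    \forall z \near xs, forall y, T phi sigma z (G z) y -> c <= dot (y - z) (y - z).
Proof.
move=> lsc cG phixs nT.
have [a phia] := finite_between (phi_gtNy xs) phixs.
have [z0] : exists z0, (phi z0 + (prox_term sigma xs (G xs) z0)%:E < a%:E)%E.
  apply: contra_notP nT => /forallNP nz; apply/T_leP => z.
  rewrite {1}/prox_term subrr !dot0r mulr0 subrr adde0 phia leNgt.
  by apply/negP; exact: nz.
case phip : (phi z0) (phi_gtNy z0) => [p||] // _.
rewrite -EFinD lte_fin => pa.
pose e := (a - (p + prox_term sigma xs (G xs) z0)) / 3.
have e0 : 0 < e by rewrite divr_gt0// subr_gt0.
have [V nV Va] : exists2 V, nbhs xs V & forall y, V y -> ((a - e)%:E < phi y)%E.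
  by apply: lsc; rewrite phia lte_fin ltrBlDr ltrDl.
(* Here [q] stands for the pair of base point [z] and displacement [y - z]. *)
have : \forall q \near (xs, 0 : 'rV[R]_n), V (q.1 + q.2) /\ dot (G q.1) q.2 < e.
  apply: filterI.
    suff : q.1 + q.2 @[q --> (xs, 0 : 'rV[R]_n)] --> xs + 0 by rewrite addr0; apply.
    by apply: cvgD; [exact: cvg_fst|exact: cvg_snd].
  have c : dot (G q.1) q.2 @[q --> (xs, 0 : 'rV[R]_n)] --> dot (G xs) 0.
    apply: cvg_dot; last exact: cvg_snd.
    by apply: continuous_cvg => //; exact: cvg_fst.
  by apply: (cvgr_lt _ c); rewrite dot0r.
move=> [[A B]/= [nA /nbhs_ballP[r r0 rB]] AB].
exists (r ^+ 2); first by rewrite exprn_gt0.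
have c : prox_term sigma z (G z) z0 @[z --> xs] --> prox_term sigma xs (G xs) z0.
  by apply: (@cvg_prox_term _ _ _ _ _ _ _ _ (nbhs_filter xs)); [exact: cvg_id|exact: cG|exact: cvg_cst].
have near_prox : \forall z \near xs, prox_term sigma z (G z) z0 < prox_term sigma xs (G xs) z0 + e.
  by apply: (cvgr_lt _ c); rewrite ltrDl.
apply: filterS2 nA near_prox => z Az zprox y /T_leP/(_ z0).
rewrite phip => Tz; rewrite leNgt; apply/negP => yz.
have [] := AB (z, y - z).
  split=> //=; apply: rB; rewrite -ball_normE/= sub0r normrN.
  exact: small_dot_ball.
rewrite /= subrKC => /Va Vy dote; move: Tz Vy.
case: (phi y) => //= b; rewrite -!EFinD lee_fin lte_fin {1}/prox_term => h1 h2.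
have : 0 <= sigma / 2 * dot (y - z) (y - z).
  by rewrite mulr_ge0 ?dot_ge0// divr_ge0// ltW.
have : a - (p + prox_term sigma xs (G xs) z0) = 3 * e.
  by rewrite /e mulrC divfK.
lra.
Qed.

(** Indices inactive at [xs] stay below by continuity. Those active at [xs] start level with [i] but
    have a strictly smaller slope along the exposed direction. *)
Lemma active_along_exposed xs i d0 : active i0 psi xs i ->
  exposed_directions i0 psi xs i d0 ->
  \forall t \near (0 : R)^'+, forall j, j != i ->
    psi j (xs + t *: d0) < psi i (xs + t *: d0).
Proof.
move=> iact [_ iexp]; apply: filter_forall => j.
have [jact|jact] := pselect (active i0 psi xs j); last first.
  have ji : 0 < psi i xs - psi j xs.
    by rewrite iact subr_gt0 lt_neqAle le_psi_max andbT; apply/eqP.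
  have c : psi i (xs + t *: d0) - psi j (xs + t *: d0) @[t --> (0 : R)^'+] -->
      psi i xs - psi j xs.
    by apply: cvgB; apply: (continuous_cvg _ _ (@cvg_ray _ _ xs d0));
      exact: psi_continuous.
  by apply: (filterS _ (cvgr_gt _ c _ ji)) => t; rewrite subr_gt0.
have [->|ji] := eqVneq j i; first exact: nearW.
have gap : 0 < dot (grad (psi i) xs) d0 - dot (grad (psi j) xs) d0.
  by rewrite -dotBl; apply: iexp => //; exact/eqP.
have c : (psi i (xs + t *: d0) - psi i xs) / t - (psi j (xs + t *: d0) - psi j xs) / t
    @[t --> (0 : R)^'+] --> dot (grad (psi i) xs) d0 - dot (grad (psi j) xs) d0.
  by apply: cvgB; apply: cvg_directional; [case: (psi_C1 i)|case: (psi_C1 j)].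
near=> t => _.
have t0 : 0 < t by near: t; exact: nbhs_right_gt.
rewrite -subr_gt0 -(pmulr_lgt0 _ (_ : 0 < t^-1)) ?invr_gt0//.
have : 0 < (psi i (xs + t *: d0) - psi i xs) / t - (psi j (xs + t *: d0) - psi j xs) / t.
  by near: t; exact: (cvgr_gt _ c _ gap).
by rewrite iact jact -mulrBl opprB addrA subrK.
Unshelve. all: by end_near. Qed.

(* The step y = T(h, grad psi_i(h)) from a perturbed point h where i is active
   satisfies zeta(y) <= zeta(u) + perturbation_error i u h - sigma/2 |y - h|^2. *)
Definition perturbation_error i (u h : 'rV[R]_n) : R :=
  psi_max i0 psi u - psi i h + prox_term sigma h (grad (psi i) h) u.

Lemma cvg_perturbation_error (S : Type) (F : set_system S) i (u h : S -> 'rV[R]_n)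
    u0 h0 : Filter F -> u @ F --> u0 -> h @ F --> h0 ->
  perturbation_error i (u s) (h s) @[s --> F] --> perturbation_error i u0 h0.
Proof.
move=> FF cu ch; apply: cvgD; first apply: cvgB.
- by apply: continuous_cvg cu; apply: psi_max_continuous; exact: psi_continuous.
- by apply: continuous_cvg ch; exact: psi_continuous.
- apply: cvg_prox_term => //; apply: continuous_cvg ch.
  by case: (psi_C1 i) => _; exact.
Qed.

(** Strict dominance forces the chosen index to be [i]. The error is less than [sigma / 2 - eta]
    times the squared step length, so the acceptance test holds, and that length squared is at least
    [c]. *)
Lemma perturbed_step_decrease i u h v c :
  (forall j, j != i -> psi j h < psi i h) ->
  (forall y, T phi sigma h (grad (psi i) h) y -> c <= dot (y - h) (y - h)) ->
  perturbation_error i u h < (sigma / 2 - eta) * c ->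
  hybrid_step i0 phi psi sigma eta u h v ->
  (zeta i0 phi psi v <= zeta i0 phi psi u - (eta * c)%:E)%E.
Proof.
move=> imax cT err [i' [y [i'act Ty]]].
have ei : i' = i.
  apply/eqP/negPn/negP => /imax; rewrite i'act ltNge.
  by rewrite le_psi_max.
subst i'; have /cT cy := Ty.
have acc : (zeta i0 phi psi y <=
    zeta i0 phi psi u - (eta * dot (y - h) (y - h))%:E)%E.
  move/T_leP/(_ u): Ty; rewrite {1}/prox_term.
  have := psi_max_gradient_le psi_convex psi_C1 y i'act.
  move: err; rewrite /perturbation_error i'act /zeta.
  case: (phi u) (phi_gtNy u) => // [b _|_ _ _ _]; last by rewrite !addye// leey.
  case: (phi y) (phi_gtNy y) => // e _ h1 h2.
  rewrite -?EFinD -?EFinB !lee_fin => h3.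
  have : (sigma / 2 - eta) * c <= (sigma / 2 - eta) * dot (y - h) (y - h).
    by rewrite ler_wpM2l// subr_ge0 ltW.
  lra.
rewrite enorm_sqr acc => ->; apply: le_trans acc _.
by rewrite leeD2l// leeN2 lee_fin ler_pM2l.
Qed.

(** The hypotheses of [perturbed_step_decrease] hold at [xs] perturbed by a short step along [d0],
    because the error vanishes without perturbation. They are stable under small changes of base
    point, step size and direction. *)
Lemma uniform_decrease_near xs i d0 (abar : R) :
  lower_semicontinuous phi -> (phi xs < +oo)%E -> active i0 psi xs i ->
  ~ T phi sigma xs (grad (psi i) xs) xs ->
  exposed_directions i0 psi xs i d0 -> 0 < abar ->
  exists a c : R, [/\ 0 < a < abar, 0 < c &
    exists (U : set 'rV[R]_n) (J : set R) (C : set 'rV[R]_n), [/\ nbhs xs U, nbhs a J, nbhs d0 C &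
      forall u t w v, U u -> J t -> C w ->
        hybrid_step i0 phi psi sigma eta u (u + t *: w) v ->
        (zeta i0 phi psi v <= zeta i0 phi psi u - c%:E)%E]].
Proof.
move=> lsc phixs iact nT iexp abar0.
have [_ cgrad] := psi_C1 i.
have [c c0 nearT] := T_displacement lsc (cgrad xs) phixs nT.
pose W := [set z | forall y, T phi sigma z (grad (psi i) z) y -> c <= dot (y - z) (y - z)].
have nW : nbhs xs W by exact: nearT.
have err0 : perturbation_error i xs xs < (sigma / 2 - eta) * c.
  rewrite /perturbation_error /prox_term iact !subrr !dot0r mulr0 subrr addr0.
  by rewrite mulr_gt0// subr_gt0.
(* The interior of [W] is required so that the condition survives moving the perturbed point. *)
have [t [tlt tmax tW terr]] : exists t, [/\ 0 < t < abar,
    forall j, j != i -> psi j (xs + t *: d0) < psi i (xs + t *: d0),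
    W° (xs + t *: d0) &
    perturbation_error i xs (xs + t *: d0) < (sigma / 2 - eta) * c].
  near (0 : R)^'+ => t; exists t; split.
  - apply/andP; split; near: t; [exact: nbhs_right_gt|exact: nbhs_right_lt].
  - by near: t; exact: active_along_exposed.
  - by near: t; exact: (@cvg_ray _ _ xs d0 _ (nbhs_interior nW)).
  - near: t; have ce : perturbation_error i xs (xs + t *: d0) @[t --> (0 : R)^'+] -->
        perturbation_error i xs xs.
      by apply: cvg_perturbation_error; [exact: cvg_cst|exact: cvg_ray].
    exact: (cvgr_lt _ ce).
exists t, (eta * c); split=> //; first exact: mulr_gt0.
have : \forall q \near (xs, (t, d0)), [/\ W (q.1 + q.2.1 *: q.2.2),
   forall j, j != i -> psi j (q.1 + q.2.1 *: q.2.2) < psi i (q.1 + q.2.1 *: q.2.2) &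
   perturbation_error i q.1 (q.1 + q.2.1 *: q.2.2) < (sigma / 2 - eta) * c].
  have ch : q.1 + q.2.1 *: q.2.2 @[q --> (xs, (t, d0))] --> xs + t *: d0.
    apply: cvgD; first exact: cvg_fst.
    apply: cvgZ; first exact: cvg_comp cvg_snd cvg_fst.
    exact: cvg_comp cvg_snd cvg_snd.
  near=> q; split; near: q.
  - exact: ch.
  - apply: filter_forall => j.
    have [->|ji] := eqVneq j i; first exact: nearW.
    have gap : 0 < psi i (xs + t *: d0) - psi j (xs + t *: d0).
      by rewrite subr_gt0 tmax.
    have cg : psi i (q.1 + q.2.1 *: q.2.2) - psi j (q.1 + q.2.1 *: q.2.2)
        @[q --> (xs, (t, d0))] --> psi i (xs + t *: d0) - psi j (xs + t *: d0).
      by apply: cvgB; apply: (continuous_cvg _ _ ch); exact: psi_continuous.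
    by apply: (filterS _ (cvgr_gt _ cg _ gap)) => q; rewrite subr_gt0.
  - have ce : perturbation_error i q.1 (q.1 + q.2.1 *: q.2.2)
        @[q --> (xs, (t, d0))] --> perturbation_error i xs (xs + t *: d0).
      by apply: cvg_perturbation_error; [exact: cvg_fst|exact: ch].
    exact: (cvgr_lt _ ce).
move=> [[U V]/= [nU [[J C]/= [nJ nC] JCV]] UV].
exists U, J, C; split=> // u s w v Uu Js Cw.
have [//|hW hmax herr] := UV (u, (s, w)); first by split=> //; exact: JCV.
move=> step; exact: (perturbed_step_decrease hmax hW herr step).
Unshelve. all: by end_near. Qed.

End Descent.

(** * Lower semicontinuity, lower bounds and cluster points *)

Section LowerSemicontinuity.
Context {R : realType} {n : nat}.
Implicit Types f : 'rV[R]_n -> \bar R.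

Lemma lower_semicontinuousB f (g : 'rV[R]_n -> R) :
  lower_semicontinuous f -> continuous g ->
  lower_semicontinuous (fun x => (f x - (g x)%:E)%E).
Proof.
move=> lsc cg x a afx.
have [b ab bf] : exists2 b : R, a + g x < b & (b%:E < f x)%E.
  move: afx; case: (f x) => [r| |] //=.
    rewrite -EFinB lte_fin => h; exists ((a + g x + r) / 2); last rewrite lte_fin; lra.
  by move=> _; exists (a + g x + 1); rewrite ?ltry// ltrDl.
have [V nV Vf] := lsc x b bf.
have nW : \forall y \near x, g y < b - a by apply: (cvgr_lt _ (cg x)); lra.
exists (V `&` [set y | g y < b - a]); first exact: filterI.
move=> y [/Vf + /= gy]; case: (f y) => [r| |] //.
  by rewrite -EFinB !lte_fin => h; lra.
by move=> _; rewrite addye// ltry.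
Qed.

Lemma bounded_below_of_lsc f (c : R) : lower_semicontinuous f ->
  (forall x, (-oo < f x)%E) -> bounded_set [set x | (f x <= c%:E)%E] ->
  exists m : R, forall x, (m%:E <= f x)%E.
Proof.
move=> lsc f_gtNy bK; set K := [set x | (f x <= c%:E)%E] in bK.
have cK : compact K.
  apply: bounded_closed_compact => //.
  have -> : K = ~` [set x | (c%:E < f x)%E].
    by apply/seteqP; split=> x /=; rewrite /K/= leNgt => /negP.
  by apply: open_closedC; move/lower_semicontinuousP : lsc; exact.
(* The local lower bounds given by semicontinuity become one bound [- N] on the compact level set;
   off it [f] exceeds [c]. *)
have /(_ nat \oo (fun k x => ((- k%:R)%:E < f x)%E)) := (compact_near_coveringP K).1 cK.
case=> [x Kx|].
  have [b bf] : exists b : R, (b%:E < f x)%E.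
    case: (f x) (f_gtNy x) => [r| |] // _; last by exists 0; rewrite ltry.
    by exists (r - 1); rewrite lte_fin ltrBlDr ltrDl.
  have [V nV Vf] := lsc x b bf.
  exists (V, [set k | - b <= k%:R]); first by split=> //; exact: nbhs_infty_ger.
  move=> [y k] [/= /Vf fy bk]; apply: le_lt_trans fy.
  by rewrite lee_fin lerNl.
move=> N _ /(_ N)/=; rewrite leqnn => /(_ isT) Kf.
exists (Num.min (- N%:R) c) => x.
have [xc|/ltW cx] := leP (f x) c%:E.
  by apply: le_trans (ltW (Kf x xc)); rewrite lee_fin ge_min lexx.
by apply: le_trans cx; rewrite lee_fin ge_min lexx orbT.
Qed.

Lemma cluster_le_lsc f (c : R) (u : nat -> 'rV[R]_n) x : lower_semicontinuous f ->
  (forall k, f (u k) <= c%:E)%E -> cluster (u k @[k --> \oo]) x -> (f x <= c%:E)%E.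
Proof.
move=> lsc uc clx; rewrite leNgt; apply/negP => /lsc[V nV Vf].
have [|y [/= yc /Vf]] := clx [set y | (f y <= c%:E)%E] V _ nV; first by exists 0%N => //= k _; exact: uc.
by rewrite ltNge yc.
Qed.

Lemma cluster_frequently (T : topologicalType) (u : nat -> T) x (U : set T) :
  cluster (u k @[k --> \oo]) x -> nbhs x U ->
  forall N, exists2 k, (N <= k)%N & U (u k).
Proof.
move=> clx nU N.
have [|_ [[k Nk <-] Uk]] := clx (u @` [set k | (N <= k)%N]) U _ nU.
  by exists N => // k Nk; exists k.
by exists k.
Qed.

End LowerSemicontinuity.

(** * Positive mass of open sets under the sampling laws *)

Section SphereLaw.
Context {R : realType} {n : nat}.

Lemma open_measurable_rV (A : set 'rV[R]_n) : open A -> measurable A.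
Proof. by move=> oA; apply: sub_sigma_algebra. Qed.

(** For distinct vectors, the Householder reflection along [u - v] works. *)
Lemma reflection_ex (u v : 'rV[R]_n) : dot u u = 1 -> dot v v = 1 ->
  exists2 Q : 'M[R]_n, Q *m Q^T = 1%:M & u *m Q = v.
Proof.
move=> uu vv; have [->|uv] := eqVneq u v.
  by exists 1%:M; rewrite ?trmx1 mulmx1.
have [w we] : exists w, w = u - v by exists (u - v).
pose c := 2 / dot w w.
have ww : dot w w != 0.
  by apply: contra uv => /eqP/dot_eq0/eqP; rewrite we subr_eq0.
have mulw : w *m w^T = (dot w w)%:M.
  by rewrite [LHS]mx11_scalar -dot_mx.
have mulu : u *m w^T = (dot u w)%:M.
  by rewrite [LHS]mx11_scalar -dot_mx.
have sym : (w^T *m w)^T = w^T *m w by rewrite trmx_mul trmxK.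
exists (1%:M - c *: (w^T *m w)).
  have -> : (1%:M - c *: (w^T *m w))^T = 1%:M - c *: (w^T *m w).
    by apply/matrixP => i j; rewrite -[in LHS]sym !mxE eq_sym.
  rewrite mulmxBl mul1mx mulmxBr mulmx1.
  rewrite -scalemxAl -scalemxAr mulmxA -(mulmxA w^T) mulw mul_mx_scalar.
  rewrite -scalemxAl !scalerA opprB.
  have -> : c * (c * dot w w) = c + c by rewrite /c; field.
  by rewrite scalerDl addrK subrK.
rewrite mulmxBr mulmx1 -scalemxAr mulmxA mulu mul_scalar_mx scalerA.
have -> : c * dot u w = 1.
  have e : dot w w = 2 * dot u w.
    by rewrite we !dotBl !dotBr uu vv (dotC v u); ring.
  have uw : dot u w != 0 by apply: contra ww; rewrite e => /eqP->; rewrite mulr0.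
  by rewrite /c e; field.
by rewrite scale1r we subKr.
Qed.

Lemma sphere_compact : compact (sphere R n).
Proof.
have c : continuous (fun u : 'rV[R]_n => dot u u).
  by move=> u; apply: (@cvg_dot _ _ _ _ _ _ _ _ (nbhs_filter u)); exact: cvg_id.
apply: bounded_closed_compact; last first.
  rewrite sphereE; apply: (preimage_closed _ (@closed_eq R 1)) => u _; exact: c.
exists 2; split => // M M2 u; rewrite sphereE/= => uu.
apply/ltW/small_dot_ball; first exact: lt_trans M2.
by rewrite uu expr_gt1 ?ltW// (lt_trans _ M2)// ltr1n.
Qed.

Lemma sphere_measurable : measurable (sphere R n).
Proof.
rewrite -[X in measurable X]setCK; apply: measurableC; apply: open_measurable_rV.
rewrite openC; apply: compact_closed; [exact: norm_hausdorff|exact: sphere_compact].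
Qed.

(** By transitivity of the orthogonal group and compactness, finitely many orthogonal preimages of
    [C] cover the sphere, and by invariance they have equal mass. The bound [p] precedes [mu], so it
    serves all iterations. *)
Lemma uniform_sphere_law_ge (C : set 'rV[R]_n) v : open C -> sphere R n v -> C v ->
  exists2 p : R, 0 < p & forall mu : probability 'rV[R]_n R,
    uniform_sphere_law mu -> (p%:E <= mu C)%E.
Proof.
move=> oC Sv Cv.
pose orth := [set Q : 'M[R]_n | Q *m Q^T = 1%:M].
pose f (Q : 'M[R]_n) := (fun u : 'rV[R]_n => u *m Q) @^-1` C.
have of_ Q : open (f Q).
  apply: open_comp => // u _.
  have -> : (fun u : 'rV[R]_n => u *m Q) = (fun u => \sum_k u 0 k *: row k Q).
    by apply/funext => w; rewrite mulmx_sum_row.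
  apply: (@cvg_big _ _ _ _ _ _ _ (nbhs u)) => [|k _]; first exact: add_continuous.
  by apply: cvgZr_tmp; exact: coord_continuous.
have := sphere_compact; rewrite compact_cover => /(_ _ orth f (fun Q _ => of_ Q)).
case=> [u|D' D'orth D'cover].
  rewrite sphereE /= => uu; have vv : dot v v = 1 by move: Sv; rewrite sphereE.
  by have [Q QQ uQ] := reflection_ex uu vv; exists Q => //=; rewrite /f/= uQ.
pose s := finmap.enum_fset D'.
(* The successor makes positivity immediate, whatever the size of the cover. *)
exists (size s).+1%:R^-1 => [|mu [muS muQ]]; first by rewrite invr_gt0.
have mf k : measurable (f (nth 1%:M s k)) by apply: open_measurable_rV; exact: of_.
have muf k : (k < size s)%N -> mu (f (nth 1%:M s k)) = mu C.
  move=> ks; apply: muQ; last exact: open_measurable_rV.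
  have : nth 1%:M s k \in s by exact: mem_nth.
  by move=> /D'orth/set_mem.
have : (mu (sphere R n) <= (size s)%:R%:E * mu C)%E.
  apply: (@le_trans _ _ (mu (\big[setU/set0]_(k < size s) f (nth 1%:M s k)))).
    apply: le_measure; [exact: (mem_set sphere_measurable)|
      by apply/mem_set; exact: bigsetU_measurable|].
    move=> u /D'cover[Q /= QD' fQ]; rewrite -(bigcup_mkord _ (fun k => f (nth 1%:M s k))).
    by exists (index Q s); rewrite /= ?index_mem// nth_index.
  apply: le_trans.
    exact: (Boole_inequality mu (A := fun k => f (nth 1%:M s k)) (fun k _ => mf k)).
  rewrite (eq_bigr (fun=> mu C)) => [|k _]; last exact: muf.
  by rewrite sumr_const card_ord mule_natl.
have -> : mu (sphere R n) = 1%E by exact: muS.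
have muC : mu C \is a fin_num by apply: fin_num_measure; exact: open_measurable_rV.
rewrite -(fineK muC) -EFinM !lee_fin => h.
have r0 : 0 <= fine (mu C) by rewrite fine_ge0.
by rewrite -div1r ler_pdivrMr// -natr1 mulrDr mulr1; lra.
Qed.

End SphereLaw.

(** A neighborhood may fail to be measurable, so it is shrunk to an interval around [c] inside
    [[a, b]], where the density is constant. *)
Lemma uniform_prob_nbhs_gt0 (R : realType) (a b c : R) (ab : a < b) (J : set R) :
  a < c < b -> nbhs c J ->
  exists J' : set R, [/\ measurable J', J' `<=` J &
    exists2 p : R, 0 < p & uniform_prob ab J' = p%:E].
Proof.
move=> /andP[ac cb] /nbhs_ballP[e /= e0 eJ].
pose r := Num.min e (Num.min (c - a) (b - c)).
have r0 : 0 < r by rewrite /r !lt_min e0 !subr_gt0 ac cb.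
have [re rac rbc] : [/\ r <= e, r <= c - a & r <= b - c].
  by rewrite /r !ge_min !lexx !orbT.
have Jab x : `](c - r), (c + r)[%classic x -> a <= x <= b.
  by rewrite /= in_itv/= => /andP[? ?]; apply/andP; split; lra.
exists `](c - r), (c + r)[%classic; split=> //.
  move=> x; rewrite /= in_itv/= => /andP[h1 h2]; apply: eJ.
  by rewrite /ball/= ltr_distlC; apply/andP; split; lra.
exists ((b - a)^-1 * (2 * r)); first by rewrite !mulr_gt0// invr_gt0 subr_gt0.
rewrite /uniform_prob (eq_integral (fun=> (b - a)^-1%:E)); last first.
  by move=> x; rewrite inE => /Jab xab; rewrite /uniform_pdf xab.
rewrite integral_cst//= lebesgue_measure_itv/= lte_fin ltrBlDr -addrA ltrDl addr_gt0//.
by rewrite -EFinB -EFinM; congr (_ * _)%:E; ring.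
Qed.

(** * Counting events and null sets *)

Section Counting.
Context d {Omega : measurableType d} {R : realType} (P : probability Omega R).
Implicit Types E F : nat -> set Omega.

(** The expected number of events [F k] is at most [N], so the probabilities of the [E k] sum to at
    most [N / p]; conclude by Borel-Cantelli. *)
Lemma frequently_null E F (p N : R) :
  (forall k, measurable (E k)) -> (forall k, measurable (F k)) -> 0 < p ->
  (forall k, (p%:E * P (E k) <= P (F k))%E) ->
  (forall w K, \sum_(k < K) \1_(F k) w <= N) ->
  P (lim_sup_set E) = 0%E.
Proof.
move=> mE mF p0 EF sumF; apply: lim_sup_set_cvg0 => //.
have partial K : (p%:E * \sum_(0 <= k < K) P (E k) <= N%:E)%E.
  rewrite big_mkord ge0_sume_distrr//.
  apply: (@le_trans _ _ (\sum_(k < K) P (F k))%E); first exact: lee_sum.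
  have -> : (\sum_(k < K) P (F k) = \int[P]_w \sum_(k < K) (\1_(F k) w)%:E)%E.
    rewrite ge0_integral_sum//=; last first.
      by move=> k; apply/measurable_EFinP; exact: measurable_indic.
    by apply: eq_bigr => k _; rewrite integral_indic// setIT.
  have -> : N%:E = (\int[P]_w (cst N%:E w))%E.
    by rewrite integral_cst// [X in (_ * X)%E]probability_setT mule1.
  apply: ge0_le_integral => //=.
  - by move=> w _; apply: sume_ge0 => k _; rewrite lee_fin.
  - apply: emeasurable_sum => k; apply/measurable_EFinP; exact: measurable_indic.
  - by move=> w _; rewrite sumEFin lee_fin; exact: sumF.
apply: (@le_lt_trans _ _ (N / p)%:E); last exact: ltry.
apply: lime_le; first exact: is_cvg_nneseries.
apply: nearW => K; rewrite EFinM lee_pdivlMr// muleC; exact: partial.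
Qed.

Lemma negligible_bigcup_null (I : countType) (N : I -> set Omega) :
  (forall i, measurable (N i)) -> P.-negligible (\bigcup_(i in [set i | P (N i) = 0%E]) N i).
Proof.
move=> mN.
(* Enumerate the countable index type, replacing the sets that are not null by the empty set. *)
pose M k := if unpickle k is Some i then if `[< P (N i) = 0%E >] then N i else set0 else set0.
apply: (@negligibleS _ _ _ _ (\bigcup_k M k)).
  by move=> w [i /= iN wi]; exists (pickle i) => //; rewrite /M pickleK asboolT.
apply: negligible_bigcup => k; rewrite /M.
case: (unpickle k) => [i|]; last exact: negligible_set0.
case: asboolP => [Ni|_]; last exact: negligible_set0.
exact/negligibleP.
Qed.

End Counting.

Lemma rational_ball_ex (R : realType) n (x : 'rV[R]_n) (U : set 'rV[R]_n) :
  nbhs x U -> exists (q : 'rV[rat]_n) (m : nat),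
    ball (map_mx (@ratr R) q) m.+1%:R^-1 x /\ ball (map_mx (@ratr R) q) m.+1%:R^-1 `<=` U.
Proof.
move=> /nbhs_ballP[e /= e0 eU].
(* Chosen so that twice the radius [m.+1%:R^-1] is at most [e]: the ball contains [x] and must stay
   within distance [e] of it. *)
pose m := Num.trunc (2 / e).
have m0 : 0 < m.+1%:R^-1 :> R by rewrite invr_gt0.
have me : m.+1%:R^-1 + m.+1%:R^-1 <= e :> R.
  have : 2 / e < m.+1%:R by exact: truncnS_gt.
  rewrite ltr_pdivrMr// => h.
  rewrite [leLHS](_ : _ = 2 / m.+1%:R); last by rewrite mulr_natl mulr2n.
  by rewrite ler_pdivrMr// ltW// mulrC.
have /choice[q qx] : forall l, exists r : rat, ball (ratr r : R) m.+1%:R^-1 (x 0 l).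
  move=> l.
  have /rat_in_itvoo[r] : x 0 l < x 0 l + m.+1%:R^-1 by rewrite ltrDl.
  rewrite in_itv/= => /andP[h1 h2]; exists r.
  by rewrite /ball/= ltr_distl h2 andbT ltrBlDr (lt_trans h1)// ltrDl.
have bx : ball (map_mx (@ratr R) (\row_l q l)) m.+1%:R^-1 x.
  by split=> // i l; rewrite !mxE (ord1 i).
exists (\row_l q l), m; split=> // y qy; apply: eU.
exact: le_ball me _ (ball_triangle (ball_sym bx) qy).
Qed.

(** * Almost sure behavior of a run *)

Section Run.
Context {R : realType} {n : nat} {I : finType} (i0 : I).
Variables (phi : 'rV[R]_n -> \bar R) (psi : I -> 'rV[R]_n -> R).
Hypothesis phi_pcc : proper_closed_convex phi.
Hypothesis psi_convex : forall i, convex_function [set: 'rV[R]_n] (psi i).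
Hypothesis psi_C1 : forall i, continuously_differentiable (psi i).
Variables (x0 : 'rV[R]_n) (x0_dom : dom (zeta i0 phi psi) x0).
Variables (sigma eta abar : R).
Hypotheses (sigma_gt0 : 0 < sigma) (eta_gt0 : 0 < eta) (eta_lt : eta < sigma / 2).
Variable abar_gt0 : 0 < abar.
Context {d : measure_display} {Omega : measurableType d} (P : probability Omega R).
Variables (alpha : nat -> {RV P >-> R}) (xi x : nat -> {RV P >-> 'rV[R]_n}).
Hypothesis A1 :
  forall c : R, bounded_set [set z | (zeta i0 phi psi z <= c%:E)%E].
Hypothesis x_run :
  hybrid_perturbed_DCA i0 phi psi x0 sigma eta abar_gt0 alpha xi x.

Local Notation zeta := (zeta i0 phi psi).

Lemma phi_gtNy y : (-oo < phi y)%E.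
Proof. by have [[+ _] _ _] := phi_pcc; apply. Qed.

Lemma zeta_gtNy y : (-oo < zeta y)%E.
Proof. by have := phi_gtNy y; rewrite /Defs.zeta; case: (phi y) => // r _; rewrite -EFinB ltNyr. Qed.

Lemma zeta_lsc : lower_semicontinuous zeta.
Proof.
have [_ lsc _] := phi_pcc; apply: lower_semicontinuousB => //.
by apply: psi_max_continuous => i; exact: psi_continuous.
Qed.

Lemma zeta_run_le k w : (zeta (x k w) <= zeta x0)%E.
Proof.
elim: k => [|k IH]; first by rewrite (dca_init x_run).
apply: le_trans IH.
exact: (hybrid_step_descent phi_gtNy psi_convex psi_C1 sigma_gt0 eta_gt0
  (dca_step x_run k w)).
Qed.

Lemma cluster_run_dom w xs : cluster (x k w @[k --> \oo]) xs -> (phi xs < +oo)%E.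
Proof.
move=> clxs; have [z0 z0E] := finite_between (zeta_gtNy x0) x0_dom.
have : (zeta xs <= z0%:E)%E.
  by apply: (cluster_le_lsc zeta_lsc _ clxs) => k; rewrite -z0E zeta_run_le.
by rewrite /Defs.zeta; case: (phi xs) => // r; rewrite ltry.
Qed.

(** Each event costs [c] of a budget: [zeta] starts at [z0], never increases and stays above [m]. *)
Lemma decrease_count_le (c : R) (F : nat -> set Omega) : 0 < c ->
  (forall k w, F k w -> (zeta (x k.+1 w) <= zeta (x k w) - c%:E)%E) ->
  exists N : R, forall w K, \sum_(k < K) \1_(F k) w <= N.
Proof.
move=> c0 Fdec; have [z0 z0E] := finite_between (zeta_gtNy x0) x0_dom.
have [m zeta_ge] := bounded_below_of_lsc zeta_lsc zeta_gtNy (A1 0).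
exists ((z0 - m) / c) => w K; rewrite ler_pdivlMr//.
have h : (zeta (x K w) <= (z0 - (\sum_(k < K) \1_(F k) w) * c)%:E)%E.
  elim: K => [|K IH].
    by rewrite big_ord0 mul0r subr0 (dca_init x_run) z0E.
  rewrite big_ord_recr/= mulrDl indicE.
  have [/set_mem FK|FK] := boolP (w \in F K).
    apply: le_trans (Fdec _ _ FK) _; rewrite mul1r opprD addrA EFinB.
    exact: leeB.
  rewrite mul0r addr0; apply: le_trans IH.
  exact: (hybrid_step_descent phi_gtNy psi_convex psi_C1 sigma_gt0 eta_gt0
    (dca_step x_run K w)).
by have := le_trans (zeta_ge _) h; rewrite lee_fin lerBrDr addrC -lerBrDr.
Qed.

(** Independence gives each good sample from [V] a conditional chance of at least [p * q], and good
    samples force a fixed decrease, hence are bounded in number. Quantifying over measurable [V]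
    inside [U] lets rational balls be substituted later. *)
Lemma nonstationary_neighborhood xs i v : (phi xs < +oo)%E ->
  active i0 psi xs i -> ~ T phi sigma xs (grad (psi i) xs) xs ->
  exposed_directions i0 psi xs i v ->
  exists2 U, nbhs xs U & forall V, V `<=` U -> measurable V ->
    P (lim_sup_set (fun k => x k @^-1` V)) = 0%E.
Proof.
move=> phixs iact nT iexp; have [_ lsc _] := phi_pcc.
have [a [c [a_itv c0 [U [J [C [nU nJ nC step_dec]]]]]]] :=
  uniform_decrease_near phi_gtNy psi_convex psi_C1 sigma_gt0 eta_gt0 eta_lt
    lsc phixs iact nT iexp abar_gt0.
have [J' [mJ' J'J [p p0 pJ']]] := uniform_prob_nbhs_gt0 abar_gt0 a_itv nJ.
have [q q0 qC] := uniform_sphere_law_ge (open_interior C) iexp.1 (nbhs_singleton (nbhs_interior nC)).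
exists U => // V VU mV.
have mC : measurable C° by apply: open_measurable_rV; exact: open_interior.
pose F k := x k @^-1` V `&` alpha k @^-1` J' `&` xi k @^-1` C°.
have [N count_le] : exists N : R, forall w K, \sum_(k < K) \1_(F k) w <= N.
  apply: (decrease_count_le c0) => k w [[wV wJ] wC].
  apply: step_dec (dca_step x_run k w); [exact: VU|exact: J'J|exact: interior_subset].
have mx k : measurable (x k @^-1` V) by exact: measurable_funPTI.
have mF k : measurable (F k).
  by apply: measurableI; [apply: measurableI|] => //; exact: measurable_funPTI.
apply: (frequently_null mx mF (mulr_gt0 p0 q0) _ count_le) => k.
rewrite (dca_indep x_run (E := x k @^-1` V))//; last first.
  (* The past at [k] includes the iterate [x k] itself. *)
  by apply: sub_sigma_algebra; left; left; exists k, V.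
have -> : P (alpha k @^-1` J') = p%:E by rewrite -pJ'; exact: (dca_alpha x_run k mJ').
rewrite [leLHS]muleC EFinM muleA; apply: lee_wpmul2l.
  by rewrite mule_ge0// lee_fin ltW.
exact: qC (dca_xi x_run k).
Qed.

End Run.

Theorem theorem2 (R : realType) (n : nat) (I : finType) (i0 : I)
  (phi : 'rV[R]_n -> \bar R) (psi : I -> 'rV[R]_n -> R)
  (phi_pcc : proper_closed_convex phi)
  (psi_inj : injective psi)
  (psi_convex : forall i, convex_function [set: 'rV[R]_n] (psi i))
  (psi_C1 : forall i, continuously_differentiable (psi i))
  (x0 : 'rV[R]_n) (x0_dom : dom (zeta i0 phi psi) x0)
  (sigma eta abar : R) (sigma_gt0 : 0 < sigma)
  (eta_gt0 : 0 < eta) (eta_lt : eta < sigma / 2) (abar_gt0 : 0 < abar)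
  (d : measure_display) (Omega : measurableType d) (P : probability Omega R)
  (alpha : nat -> {RV P >-> R}) (xi x : nat -> {RV P >-> 'rV[R]_n})
  (A1 : forall c : R, bounded_set [set z | (zeta i0 phi psi z <= c%:E)%E])
  (x_run : hybrid_perturbed_DCA i0 phi psi x0 sigma eta abar_gt0 alpha xi x)
  (A4 : forall (w : Omega) (xs : 'rV[R]_n),
     cluster (x k w @[k --> \oo]) xs ->
     forall i, active i0 psi xs i ->
       exposed_directions i0 psi xs i !=set0) :
  {ae P, forall w, forall xs : 'rV[R]_n,
     cluster (x k w @[k --> \oo]) xs -> d_stationary (zeta i0 phi psi) xs}.
Proof.
pose V (qm : 'rV[rat]_n * nat) : set 'rV[R]_n :=
  ball (map_mx (@ratr R) qm.1) qm.2.+1%:R^-1.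
have mV qm : measurable (V qm) by apply: open_measurable_rV; exact: ball_open.
pose E qm k := x k @^-1` V qm.
have mE qm : measurable (lim_sup_set (E qm)).
  apply: bigcap_measurable => // k _; apply: bigcup_measurable => j _.
  exact: measurable_funPTI.
(* The bad outcomes are only covered by a countable union of null sets; their own measurability is
   not at stake. *)
apply: negligibleS (negligible_bigcup_null P mE) => w /= /existsNP[xs /not_implyP[clxs nstat]].
have phixs := cluster_run_dom phi_pcc psi_convex psi_C1 x0_dom sigma_gt0 eta_gt0 x_run clxs.
have [i iact nT] : exists2 i, active i0 psi xs i & ~ T phi sigma xs (grad (psi i) xs) xs.
  apply: contra_notP nstat => /forall2NP allT.
  apply: (d_stationary_of_T (sigma := sigma) psi_convex psi_C1 (phi_gtNy phi_pcc) _ phixs) => [|i iact].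
    by case: phi_pcc.
  by have [/(_ iact)|/contrapT] := allT i.
have [v iexp] := A4 w xs clxs i iact.
have [U nU Unull] := nonstationary_neighborhood phi_pcc psi_convex psi_C1 x0_dom
  sigma_gt0 eta_gt0 eta_lt A1 x_run phixs iact nT iexp.
(* The neighborhood [U] varies with [xs] in an uncountable family; a rational ball inside it brings
   the exceptional sets down to countably many. *)
have [q [m [qxs qU]]] := rational_ball_ex nU.
exists (q, m); first by apply: Unull => //; exact: mV (q, m).
move=> N _; have nV : nbhs xs (V (q, m)).
  by apply: open_nbhs_nbhs; split => //; exact: ball_open.
by have [k Nk Vk] := cluster_frequently clxs nV N; exists k.
Qed.
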